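(* Consider the restricted system of two bouncing balls in which $P_1$ has zero mass, $P_2$ has non-zero mass, and $P_1$ is situated between the plate $z=f(t)$ and the ball $P_2$. If $f$ is a periodic function of class $C^1$, then there exist bounded motions of $P_2$, and if $f\in\mathcal{C}$ then there exist unbounded motions of $P_2$, for each of which an open set with infinite measure of initial conditions for the ball $P_1$ leads to $P_1$ having infinite velocity in finite time.
   Context: Restricted system of two bouncing balls: two elastic point particles $P_1,P_2$ move on a vertical line (coordinate $z$) in a gravitational field with constant acceleration $g>0$ (so $\ddot z=-g$ for each ball between collisions), above an infinitely heavy horizontal plate which oscillates according to $z=f(t)$, where $f$ has period $T>0$. The mass of $P_1$ is zero and that of $P_2$ is non-zero. Here the lower ball is $P_1$ and the upper ball is $P_2$. At a collision of a ball with the plate at time $s$, its velocity $v^-$ becomes $v^+=-v^-+2\dot f(s)$. The two balls interact according to the law of elastic collisions, and $P_1$ does not influence $P_2$ since it has zero mass: at a collision between the balls the velocity $v^{(2)}$ of $P_2$ is unchanged and the velocity $v^{(1)}_-$ of $P_1$ becomes $v^{(1)}_+=-v^{(1)}_-+2v^{(2)}$. Thus the motion of $P_2$ is that of a single ball bouncing elastically on the plate under gravity; it continues through a triple collision (both balls and the plate simultaneously), while the motion of $P_1$ cannot be continued through a triple collision. A motion of $P_2$ is bounded if its velocity $v^{(2)}(\tau)$ satisfies $\sup_\tau|v^{(2)}(\tau)|<\infty$, and unbounded otherwise. An initial condition for $P_1$ is a pair $(v_0,t_0)$, meaning that $P_1$ leaves the plate at time $t_0$ with velocity $v_0$; measure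 is Lebesgue measure on the set of such pairs. $P_1$ has infinite velocity in finite time if there is a finite time $t^*>t_0$ such that its velocity $v^{(1)}(\tau)$ satisfies $\lim_{\tau\nearrow t^*}|v^{(1)}(\tau)|=\infty$. Class $\mathcal{C}$: $\mathcal{C}:=\{f: f \text{ is periodic with period } T \text{ and there exists } t_0 \text{ with } \dot f(t_0)=KTg/2 \text{ for some positive integer } K\}$. *)

(* Defs.v *)
From HB Require Import structures.
From mathcomp Require Import all_boot all_order all_algebra.
From mathcomp Require Import all_classical all_reals all_analysis.
Set Implicit Arguments.
Unset Strict Implicit.
Unset Printing Implicit Defensive.
Import Order.TTheory GRing.Theory Num.Theory.
Import numFieldNormedType.Exports.
Local Open Scope classical_set_scope.
Local Open Scope ring_scope.

(* Positions [z] and velocities [v] are functions of time; their values outside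
   the time interval of the motion are irrelevant.  At a collision time [t],
   [v t] is the velocity after the collision, so that [v] is right-continuous,
   and the velocity before the collision is the left limit of [v] at [t]. *)

Definition free_fall (R : realType) (g : R) (z v : R -> R) (t : R) : Prop :=
  is_derive t 1 z (v t) /\ is_derive t 1 v (- g).

(* Collision at time [t] with an obstacle of velocity [w] that is infinitely
   heavy compared with the ball: [v^+ = - v^- + 2 w]. *)
Definition elastic_collision (R : realType) (v : R -> R) (t w : R) : Prop :=
  exists vm : R, v x @[x --> t^'-] --> vm /\ v t = - vm + 2 * w.

Definition class_C1 (R : realType) (f : R -> R) : Prop :=
  (forall t, derivable f t 1) /\ continuous (derive1 f).

Definition class_C (R : realType) (g T : R) : set (R -> R) :=
  [set f | periodic f T /\
    exists (t0 : R) (K : nat), (0 < K)%N /\ is_derive t0 1 f (K%:R * T * g / 2)].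

(* A motion of the upper ball on [s0, +oo[.  Finiteness of the collisions in
   bounded time excludes a ball resting on the plate, for which the left limit
   above would not be the velocity of a free fall. *)
Record P2_motion (R : realType) (g : R) (f : R -> R) (s0 : R) (z2 v2 : R -> R)
    : Prop := {
  P2_above : forall t, s0 <= t -> f t <= z2 t ;
  P2_continuous : {within `[s0, +oo[, continuous z2} ;
  P2_rcontinuous : forall t, s0 <= t -> v2 x @[x --> t^'+] --> v2 t ;
  P2_free : forall t, s0 < t -> f t < z2 t -> free_fall g z2 v2 t ;
  P2_plate : forall t, s0 < t -> z2 t = f t ->
    elastic_collision v2 t (derive1 f t) ;
  P2_discrete : forall b, finite_set [set t | s0 <= t <= b /\ z2 t = f t] }.

Definition P2_bounded (R : realType) (s0 : R) (v2 : R -> R) : Prop :=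
  has_ubound [set `|v2 t| | t in `[s0, +oo[].

(* A motion on [t0, tstar[ of the massless lower ball, which leaves the plate
   at time [t0] with velocity [v0].  As [f t < z2 t] there, no triple collision
   occurs on this interval, and [v2 t] is the velocity of the upper ball both
   before and after a collision of the two balls at time [t]. *)
Record P1_motion (R : realType) (g : R) (f z2 v2 : R -> R) (v0 t0 tstar : R)
    (z1 v1 : R -> R) : Prop := {
  P1_initial_position : z1 t0 = f t0 ;
  P1_initial_velocity : v1 t0 = v0 ;
  P1_no_triple : forall t, t0 <= t < tstar -> f t < z2 t ;
  P1_between : forall t, t0 <= t < tstar -> f t <= z1 t <= z2 t ;
  P1_continuous : {within `[t0, tstar[, continuous z1} ;
  P1_rcontinuous : forall t, t0 <= t < tstar -> v1 x @[x --> t^'+] --> v1 t ;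
  P1_free : forall t, t0 < t < tstar -> f t < z1 t < z2 t ->
    free_fall g z1 v1 t ;
  P1_plate : forall t, t0 < t < tstar -> z1 t = f t ->
    elastic_collision v1 t (derive1 f t) ;
  P1_ball : forall t, t0 < t < tstar -> z1 t = z2 t ->
    elastic_collision v1 t (v2 t) ;
  P1_discrete : forall b, b < tstar ->
    finite_set [set t | t0 <= t <= b /\ (z1 t = f t \/ z1 t = z2 t)] }.

Definition infinite_velocity_in_finite_time (R : realType) (g : R) (f : R -> R)
    (s0 : R) (z2 v2 : R -> R) (v0 t0 : R) : Prop :=
  s0 <= t0 /\
  exists (tstar : R) (z1 v1 : R -> R),
    [/\ t0 < tstar, P1_motion g f z2 v2 v0 t0 tstar z1 v1 &
        `|v1 t| @[t --> tstar^'-] --> +oo].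

(* The initial conditions are the pairs (v0, t0). *)
Definition open_infinite_blowup (R : realType) (g : R) (f : R -> R)
    (s0 : R) (z2 v2 : R -> R) : Prop :=
  exists U : set (R * R),
    [/\ open U,
        (@lebesgue_measure R \x @lebesgue_measure R)%E U = +oo%E &
        forall v0 t0 : R, U (v0, t0) ->
          infinite_velocity_in_finite_time g f s0 z2 v2 v0 t0].

(* Main.v *)
Require Import Defs.
From HB Require Import structures.
From mathcomp Require Import all_boot all_order all_algebra.
From mathcomp Require Import all_classical all_reals all_analysis.
From mathcomp Require Import ring lra.
Import Order.TTheory GRing.Theory Num.Theory.
Import numFieldNormedType.Exports.
Set Implicit Arguments.
Unset Strict Implicit.
Unset Printing Implicit Defensive.
Local Open Scope classical_set_scope.
Local Open Scope ring_scope.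

(** The blow-up is caused by a single transversal collision of the upper ball
    with the plate, i.e. one at which the gap between them closes at a positive
    rate.

    Every motion of the upper ball has such a collision
    ([P2_transversal_collision]): otherwise all collisions are tangential and
    leave the velocity continuous, and the ball falls freely for ever, which is
    impossible above a bounded plate.  Shortly before a transversal collision
    at time [s] the gap [h] is of class C1 and decreases at a rate between two
    positive constants [m] and [M].  Seen from the upper ball, gravity
    disappears and the massless ball moves in straight lines between a wall at
    depth 0 and a wall at depth [h].  If its relative speed [p] exceeds [M], it
    goes up and returns to the plate before [s], and the plate adds at least
    [2 m] to its speed ([next_plate_hit], [plate_hits]).  Hence it hits the
    plate infinitely often before [s] with speeds tending to infinity, and its
    velocity diverges where the hits accumulate ([trapped_motion],
    [trapped_blowup]).  This holds for all starting times in a nonempty open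
    interval that ends at [s] and all initial velocities above a threshold:
    the product of a ray and an interval, which is open and of infinite measure.

    The required motions of the upper ball bounce at a fixed phase [c] of the
    plate, with flight times that are multiples of the period
    ([bounce_motion]).  A maximum of [f] gives a periodic, hence bounded, motion
    ([bounded_motion_exists]); a phase with [f' c = K T g / 2] gives flights
    that lengthen by [2 K] periods at each bounce, and unbounded speed
    ([unbounded_motion_exists]). *)

(** * One-sided limits and piecewise functions *)

Section Pieces.
Context {R : realType}.
Implicit Types (a b t : R) (P : R -> Prop) (F G : R -> R).

Lemma is_derive_continuous F t d : is_derive t 1 F d -> {for t, continuous F}.
Proof. by case=> Ft _; exact/differentiable_continuous/derivable1_diffP. Qed.

Lemma near_itv a b t P : a < t < b -> (forall x, a < x < b -> P x) ->
  \forall x \near t, P x.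
Proof.
move=> /andP[at_ tb] abP; near=> x; apply: abP.
by apply/andP; split; near: x; [exact: lt_nbhsr | exact: lt_nbhsl].
Unshelve. all: by end_near. Qed.

Lemma near_itv_left a t P : a < t -> (forall x, a < x < t -> P x) ->
  \forall x \near t^'-, P x.
Proof.
move=> at_ aP; near=> x; apply: aP.
by apply/andP; split; near: x; [exact: nbhs_left_gt | exact: nbhs_left_lt].
Unshelve. all: by end_near. Qed.

Lemma near_itv_right b t P : t < b -> (forall x, t < x < b -> P x) ->
  \forall x \near t^'+, P x.
Proof.
move=> tb bP; near=> x; apply: bP.
by apply/andP; split; near: x; [exact: nbhs_right_gt | exact: nbhs_right_lt].
Unshelve. all: by end_near. Qed.

Lemma eq_itv_cvg_left a t F G : a < t -> (forall x, a < x < t -> F x = G x) ->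
  {for t, continuous G} -> F x @[x --> t^'-] --> G t.
Proof.
move=> at_ FG Gt; apply: cvg_trans (cvg_at_left_filter Gt).
by apply: near_eq_cvg; apply: near_itv_left at_ _ => x /FG.
Qed.

Lemma eq_itv_cvg_right b t F G : t < b -> (forall x, t < x < b -> F x = G x) ->
  {for t, continuous G} -> F x @[x --> t^'+] --> G t.
Proof.
move=> tb FG Gt; apply: cvg_trans (cvg_at_right_filter Gt).
by apply: near_eq_cvg; apply: near_itv_right tb _ => x /FG.
Qed.

(** The default 0 makes a piecewise function agree with its first piece to the
    left of [u 0], so that it is continuous at [u 0] from both sides. *)
Definition piece (u : nat -> R) t : nat := xget 0 [set n | u n <= t < u n.+1].

Definition piecewise (u : nat -> R) (F : nat -> R -> R) t := F (piece u t) t.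

Variable u : nat -> R.
Hypothesis u_incr : forall n, u n < u n.+1.

Lemma incr_le m n : (m <= n)%N -> u m <= u n.
Proof.
by move=> mn; apply: (homo_leq (r := <=%R)) mn => // [y x z|i];
  [exact: le_trans | exact: ltW].
Qed.

Lemma piece_eq n t : u n <= t < u n.+1 -> piece u t = n.
Proof.
move=> /andP[nt tn]; rewrite /piece.
case: xgetP => [m _ /andP[mt tm]|/(_ n)]; last by rewrite /= nt tn.
by apply/eqP; rewrite eqn_leq; apply/andP; split; rewrite leqNgt;
  apply/negP => /incr_le; apply/negP; rewrite -ltNge; apply: le_lt_trans;
  eassumption.
Qed.

Lemma piece_before t : t < u 0 -> piece u t = 0%N.
Proof.
move=> t0; rewrite /piece; case: xgetP => // n _ /andP[nt _].
by have := le_lt_trans (le_trans (incr_le (leq0n n)) nt) t0; rewrite ltxx.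
Qed.

Lemma piece_exists t N : u 0 <= t -> t < u N -> exists n, u n <= t < u n.+1.
Proof.
move=> t0 tN; have [n tn min_n] := ex_minnP (ex_intro (fun n => t < u n) N tN).
case: n tn min_n => [|n] tn min_n; first by move: tn; rewrite ltNge t0.
exists n; rewrite tn andbT leNgt; apply/negP => /min_n; by rewrite ltnn.
Qed.

Variable F : nat -> R -> R.

Lemma piecewiseE n t : u n <= t < u n.+1 -> piecewise u F t = F n t.
Proof. by move=> /piece_eq; rewrite /piecewise => ->. Qed.

Lemma piecewise_near n t : u n < t < u n.+1 -> \forall x \near t, F n x = piecewise u F x.
Proof.
move=> /near_itv; apply=> x /andP[nx xn].
by rewrite (@piecewiseE n)// (ltW nx).
Qed.

Lemma piecewise_cvg_right n t : u n <= t < u n.+1 -> {for t, continuous (F n)} ->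
  piecewise u F x @[x --> t^'+] --> piecewise u F t.
Proof.
move=> ntn Fn; rewrite (piecewiseE ntn); move: ntn => /andP[nt tn].
apply: eq_itv_cvg_right tn _ Fn => x /andP[tx xn]; rewrite (@piecewiseE n)//.
by rewrite (le_trans nt (ltW tx)).
Qed.

Lemma piecewise_cvg_left n t : u n < t <= u n.+1 -> {for t, continuous (F n)} ->
  piecewise u F x @[x --> t^'-] --> F n t.
Proof.
move=> /andP[nt tn] Fn; apply: eq_itv_cvg_left nt _ Fn => x /andP[nx xt].
by rewrite (@piecewiseE n)// (ltW nx) (lt_le_trans xt).
Qed.

Lemma piecewise_derive n t d : u n < t < u n.+1 -> is_derive t 1 (F n) d ->
  is_derive t 1 (piecewise u F) d.
Proof. by move=> /piecewise_near/near_eq_is_derive; apply. Qed.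

Hypothesis F_cont : forall n, continuous (F n).
Hypothesis F_match : forall n, F n (u n.+1) = F n.+1 (u n.+1).

Lemma piecewise_continuous N t : u 0 <= t < u N -> {for t, continuous (piecewise u F)}.
Proof.
move=> /andP[t0 tN]; have [n ntn] := piece_exists t0 tN.
apply/left_right_continuousP; split; last first.
  by apply: (piecewise_cvg_right ntn); exact: F_cont.
rewrite (piecewiseE ntn); move: ntn => /andP[]; rewrite le_eqVlt => /orP[/eqP<-|nt] tn.
  case: n tn => [|n] tn; last first.
    by rewrite -F_match; apply: piecewise_cvg_left; [rewrite lexx andbT|exact: F_cont].
  apply: (@eq_itv_cvg_left (u 0 - 1)); [lra| |exact: F_cont].
  by move=> x /andP[_ x0]; rewrite /piecewise piece_before.
by apply: piecewise_cvg_left; [rewrite nt ltW|exact: F_cont].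
Qed.

End Pieces.

(** * Periodic functions *)

Section Periodic.
Context {R : realType}.
Variables (f : R -> R) (T : R).
Hypotheses (T_gt0 : 0 < T) (f_per : periodic f T).

Lemma periodicz (k : int) x : f (x + T * k%:~R) = f x.
Proof.
have pos n y : f (y + T * n%:R) = f y by rewrite mulr_natr periodicn.
case: k => n; first exact: pos.
by rewrite -[LHS](pos n.+1) NegzE mulrNz mulrN subrK.
Qed.

Lemma periodic_attains_max : continuous f -> exists c, forall x, f x <= f c.
Proof.
move=> f_cont; have [c _ cmax] : exists2 c, c \in `[0, T] &
    forall x, x \in `[0, T] -> f x <= f c.
  apply: (EVT_max (ltW T_gt0)).
  exact: continuous_subspaceT.
exists c => x; rewrite -(periodicz (- Num.floor (x / T))) cmax//.
have := floor_le (x / T); have := floorD1_gt (x / T).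
rewrite intrD rmorphN/= in_itv/=.
set k := (_)%:~R => xk kx.
have : x < T * (k + 1) by rewrite mulrC -ltr_pdivrMr.
have : k * T <= x by rewrite -ler_pdivlMr.
by move: k {kx xk} => k; nra.
Qed.

Lemma periodic_derive1 : periodic (derive1 f) T.
Proof.
move=> x; rewrite /derive1.
by under eq_fun => h do rewrite addrA !f_per.
Qed.

End Periodic.

(** * Motions that bounce at a fixed phase of the plate *)

Section BouncingMotion.
Context {R : realType}.
Variables (g T c : R) (f : R -> R) (d : nat -> nat).
Hypotheses (g_gt0 : 0 < g) (T_gt0 : 0 < T) (f_per : periodic f T).
Hypotheses (d_gt0 : forall n, (0 < d n)%N)
  (d_step : forall n, g * T * ((d n.+1)%:R - (d n)%:R) = 4 * derive1 f c)
  (d_above : forall n s, 0 < s < T * (d n)%:R ->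
    f (c + s) < f c + g / 2 * (s * (T * (d n)%:R - s))).

Definition bounce_time n : R := c + T * (\sum_(i < n) d i)%:R.

(** With roots at both ends of the flight, the height matches across bounces by
    construction; the price is a condition on [d] for the velocities. *)
Definition flight_height n t : R :=
  f c + g / 2 * ((t - bounce_time n) * (bounce_time n.+1 - t)).

Definition flight_velocity n t : R :=
  g / 2 * (bounce_time n + bounce_time n.+1 - 2 * t).

Let u := bounce_time.
Definition bounce_height := piecewise u flight_height.
Definition bounce_velocity := piecewise u flight_velocity.

Lemma bounce_timeS n : u n.+1 = u n + T * (d n)%:R.
Proof. by rewrite /u /bounce_time big_ord_recr natrD mulrDr addrA. Qed.

Lemma bounce_time0 : u 0 = c.
Proof. by rewrite /u /bounce_time big_ord0 mulr0 addr0. Qed.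

Lemma f_bounce_time n s : f (u n + s) = f (c + s).
Proof. by rewrite /u /bounce_time mulr_natr addrAC periodicn. Qed.

Lemma bounce_time_incr n : u n < u n.+1.
Proof. by rewrite bounce_timeS ltrDl mulr_gt0// ltr0n. Qed.

Lemma bounce_time_unbounded b : exists N, b < u N.
Proof.
have uD n : c + T * n%:R <= u n.
  elim: n => [|n IH]; first by rewrite bounce_time0 mulr0 addr0.
  rewrite bounce_timeS -natr1 mulrDr addrA lerD// mulr1 ler_peMr ?(ltW T_gt0)//.
  by rewrite ler1n.
exists (Num.bound `|(b - c) / T|); apply: lt_le_trans (uD _).
rewrite -ltrBlDl mulrC -ltr_pdivrMr//.
by rewrite (le_lt_trans (ler_norm _))// archi_boundP.
Qed.

Lemma bounce_time_cover t : c <= t -> exists n, u n <= t < u n.+1.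
Proof.
rewrite -bounce_time0 => t0; have [N tN] := bounce_time_unbounded t.
exact: piece_exists t0 tN.
Qed.

Lemma flight_height_derive n (t : R) :
  is_derive t 1 (flight_height n) (flight_velocity n t).
Proof.
rewrite /flight_height /flight_velocity; apply: is_derive_eq.
rewrite /GRing.scale /=; ring.
Qed.

Lemma flight_velocity_derive n (t : R) : is_derive t 1 (flight_velocity n) (- g).
Proof.
rewrite /flight_velocity; apply: is_derive_eq.
rewrite /GRing.scale /=; lra.
Qed.

Lemma flight_height_cont n : continuous (flight_height n).
Proof.
by move=> t; apply: is_derive_continuous (flight_height_derive n t).
Qed.

Lemma flight_velocity_cont n : continuous (flight_velocity n).
Proof.
by move=> t; apply: is_derive_continuous (flight_velocity_derive n t).
Qed.

Lemma flight_height_match n :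
  flight_height n (u n.+1) = flight_height n.+1 (u n.+1).
Proof. by rewrite /flight_height !subrr mul0r !mulr0. Qed.

Lemma bounce_heightE n t : u n <= t < u n.+1 ->
  bounce_height t = flight_height n t.
Proof. exact: (piecewiseE bounce_time_incr). Qed.

Lemma bounce_velocityE n t : u n <= t < u n.+1 ->
  bounce_velocity t = flight_velocity n t.
Proof. exact: (piecewiseE bounce_time_incr). Qed.

Lemma bounce_height_at n : bounce_height (u n) = f (u n).
Proof.
rewrite (@bounce_heightE n).
  by rewrite /flight_height subrr mul0r mulr0 addr0 -[u n]addr0 f_bounce_time addr0.
by rewrite lexx bounce_time_incr.
Qed.

Lemma bounce_height_above n t : u n < t < u n.+1 -> f t < bounce_height t.
Proof.
move=> /andP[nt tn]; rewrite (@bounce_heightE n).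
  have := d_above (n := n) (s := t - u n).
  rewrite -(f_bounce_time n) subrKC /flight_height -/u bounce_timeS.
  rewrite opprB addrCA addrA => -> //.
  by move: tn; rewrite bounce_timeS => tn; apply/andP; split; lra.
by rewrite (ltW nt).
Qed.

Lemma bounce_height_plate t : c <= t -> bounce_height t = f t -> exists n, t = u n.
Proof.
move=> /bounce_time_cover[n /andP[]]; rewrite le_eqVlt => /orP[/eqP<-|nt tn Et].
  by exists n.
have := @bounce_height_above n t; rewrite nt tn Et ltxx => /(_ isT); by [].
Qed.

(** Every bounce takes place at the phase [c] of the plate, with incoming
    velocity [- g T d n / 2] and outgoing velocity [g T d n.+1 / 2]; the
    hypothesis on the steps of [d] is the collision law between the two. *)
Lemma bounce_motion : P2_motion g f c bounce_height bounce_velocity.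
Proof.
have lecW t : c < t -> c <= t by exact: ltW.
split.
- move=> t /bounce_time_cover[n /andP[]]; rewrite le_eqVlt.
  move=> /orP[/eqP<- _|nt tn]; first by rewrite bounce_height_at.
  by apply/ltW/(@bounce_height_above n); rewrite nt.
- apply: continuous_in_subspaceT => t; rewrite inE/= in_itv/= andbT => ct.
  have [N tN] := bounce_time_unbounded t.
  apply: (piecewise_continuous bounce_time_incr flight_height_cont
    flight_height_match (N := N)).
  by rewrite bounce_time0 ct.
- move=> t /bounce_time_cover[n ntn].
  by apply: (piecewise_cvg_right bounce_time_incr ntn); exact: flight_velocity_cont.
- move=> t /lecW/bounce_time_cover[n /andP[]]; rewrite le_eqVlt.
  move=> /orP[/eqP<- _|nt tn _]; first by rewrite bounce_height_at ltxx.
  have ntn : u n < t < u n.+1 by rewrite nt.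
  have vt : bounce_velocity t = flight_velocity n t.
    by apply: bounce_velocityE; rewrite ltW.
  split.
    apply: is_derive_eq (esym vt); apply: (piecewise_derive bounce_time_incr ntn).
    exact: flight_height_derive.
  apply: (piecewise_derive bounce_time_incr ntn).
  exact: flight_velocity_derive.
- move=> t ct /(bounce_height_plate (ltW ct))[[|n] tn].
    by move: ct; rewrite tn bounce_time0 ltxx.
  exists (flight_velocity n t); split.
    apply: (piecewise_cvg_left bounce_time_incr); last exact: flight_velocity_cont.
    by rewrite tn bounce_time_incr lexx.
  rewrite (@bounce_velocityE n.+1); last first.
    by rewrite tn bounce_time_incr lexx.
  have -> : derive1 f t = derive1 f c.
    rewrite tn /u /bounce_time mulr_natr.
    by rewrite periodicn//; exact: periodic_derive1.
  rewrite /flight_velocity -/u tn !bounce_timeS.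
  by have := d_step n; lra.
- move=> b; have [N bN] := bounce_time_unbounded b.
  apply: (@sub_finite_set _ _ (u @` `I_N)); last exact/finite_image/finite_II.
  move=> t [/andP[ct tb] /(bounce_height_plate ct)[n tn]]; exists n => //=.
  rewrite ltnNge; apply/negP => /(incr_le bounce_time_incr).
  by rewrite -/u -tn; apply/negP; rewrite -ltNge (le_lt_trans tb).
Qed.

End BouncingMotion.

Section Existence.
Context {R : realType}.
Variables (g T : R) (f : R -> R).
Hypotheses (g_gt0 : 0 < g) (T_gt0 : 0 < T) (f_per : periodic f T) (f_C1 : class_C1 f).

Lemma C1_is_derive (x : R) : is_derive x 1 f (derive1 f x).
Proof. by rewrite derive1E; apply: derivableP; exact: f_C1.1. Qed.

Lemma C1_continuous : continuous f.
Proof. by move=> x; exact: is_derive_continuous (C1_is_derive x). Qed.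

(** Where [f] is maximal the plate is momentarily at rest, so that a ball which
    leaves it there with velocity [g T / 2] returns one period later and bounces
    back with the same speed; in between it flies above the maximum of [f]. *)
Lemma bounded_motion_exists : exists (s0 : R) (z2 v2 : R -> R),
  P2_motion g f s0 z2 v2 /\ P2_bounded s0 v2.
Proof.
have [c cmax] := periodic_attains_max T_gt0 f_per C1_continuous.
have fc0 : derive1 f c = 0.
  rewrite derive1E; apply/derive_val/(@derive1_at_max _ f (c - 1) (c + 1)).
  - by lra.
  - by move=> t _; exact: f_C1.1.
  - by rewrite in_itv/=; apply/andP; split; lra.
  - by move=> t _; exact: cmax.
pose d (n : nat) := 1%N.
have d_gt0 n : (0 < d n)%N by [].
exists c, (bounce_height g T c f d), (bounce_velocity g T c d); split.
  apply: bounce_motion => //.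
    by move=> n; rewrite subrr fc0 !mulr0.
  move=> n s; rewrite mulr1 => /andP[s0 sT].
  by rewrite (le_lt_trans (cmax _))// ltrDl !mulr_gt0 ?invr_gt0 ?subr_gt0.
exists (g / 2 * T) => _ [t /= ct <-].
move: ct; rewrite in_itv/= andbT => ct.
have [n ntn] := @bounce_time_cover _ T c d T_gt0 d_gt0 t ct.
rewrite (bounce_velocityE g T_gt0 d_gt0 ntn) /flight_velocity.
move: ntn; rewrite bounce_timeS mulr1 => /andP[nt tn].
rewrite normrM gtr0_norm ?divr_gt0// ler_pM2l ?divr_gt0//.
by rewrite ler_norml; apply/andP; split; lra.
Qed.

Lemma C1_periodic_lipschitz : exists2 L, 0 <= L &
  forall x y, x <= y -> `|f y - f x| <= L * (y - x).
Proof.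
have [c cmax] : exists c, forall x, `|derive1 f x| <= `|derive1 f c|.
  apply: (@periodic_attains_max _ (fun x => `|derive1 f x|) T T_gt0).
    by move=> x; rewrite (periodic_derive1 f_per).
  move=> x; apply: continuous_comp; first exact: f_C1.2.
  exact: norm_continuous.
exists `|derive1 f c| => // x y xy.
have [|z _ ->] := MVT_segment xy (fun z _ => C1_is_derive z).
  by apply: continuous_subspaceT; exact: C1_continuous.
by rewrite normrM ler_pM// [`|y - x|]ger0_norm// subr_ge0.
Qed.

(** Resonance: a bounce at a phase [c] with [f' c = K T g / 2] raises the speed
    by [K T g], hence lengthens the flight by [2 K] whole periods, and the ball
    lands at phase [c] again.  If the first flight is long enough, the parabola
    lies above the lines through its end points that bound [f] by means of a
    Lipschitz constant, so that no other collision occurs. *)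
Lemma unbounded_motion_exists : class_C g T f -> exists (s0 : R) (z2 v2 : R -> R),
  P2_motion g f s0 z2 v2 /\ ~ P2_bounded s0 v2.
Proof.
move=> [_ [c [K [K_gt0 fcK]]]].
have fc : derive1 f c = K%:R * T * g / 2 by rewrite derive1E derive_val.
have [L L0 Llip] := C1_periodic_lipschitz.
have gT_gt0 : 0 < g * T by exact: mulr_gt0.
set m := (Num.bound (4 * L / (g * T))).
have mL : 4 * L < g * T * m%:R.
  rewrite [ltRHS]mulrC -ltr_pdivrMr//; apply: archi_boundP.
  by rewrite divr_ge0 ?mulr_ge0// ltW.
pose d n := (m + 2 * K * n)%N.
have d_gt0 n : (0 < d n)%N.
  rewrite /d addn_gt0; apply/orP; left; rewrite lt0n; apply/eqP => m0.
  by move: mL; rewrite m0 mulr0 ltNge mulr_ge0.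
exists c, (bounce_height g T c f d), (bounce_velocity g T c d); split.
  apply: bounce_motion => //.
    by move=> n; rewrite fc /d -[n.+1]addn1 !(natrD, natrM); lra.
  move=> n s /andP[s0 sT].
  have dm : m%:R <= (d n)%:R :> R by rewrite ler_nat leq_addr.
  have gTd : 4 * L < g * T * (d n)%:R.
    by apply: (lt_le_trans mL); rewrite ler_pM2l.
  have up : f (c + s) - f c <= L * s.
    have : `|f (c + s) - f c| <= L * (c + s - c) by apply: Llip; lra.
    by rewrite addrAC subrr add0r; apply: le_trans; exact: ler_norm.
  have down : f (c + s) - f c <= L * (T * (d n)%:R - s).
    have fcd : f (c + T * (d n)%:R) = f c by rewrite mulr_natr periodicn.
    have : `|f (c + T * (d n)%:R) - f (c + s)| <= L * (c + T * (d n)%:R - (c + s)).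
      by apply: Llip; lra.
    rewrite fcd distrC opprD addrACA subrr add0r.
    by apply: le_trans; exact: ler_norm.
  move: (T * _) up down sT (mulrA g T (d n)%:R) gTd => D up down sT <- gTd.
  (* Compare with the take-off in the first half and with the landing in the
     second half of the flight. *)
  have [sD|/ltW Ds] := leP (2 * s) D.
    have : 0 < s * (g * D - 4 * L) by rewrite mulr_gt0 ?subr_gt0.
    have : 0 <= g * s * (D - 2 * s) by rewrite !mulr_ge0 ?subr_ge0// ltW.
    lra.
  have : 0 < (D - s) * (g * D - 4 * L) by rewrite mulr_gt0 ?subr_gt0.
  have : 0 <= g * (D - s) * (2 * s - D) by rewrite !mulr_ge0 ?subr_ge0// ltW.
  lra.
move=> [B vB].
have vn n : bounce_velocity g T c d (bounce_time T c d n) = g * T * (d n)%:R / 2.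
  rewrite (@bounce_velocityE _ g T c d T_gt0 d_gt0 n); last first.
    by rewrite lexx bounce_time_incr.
  by rewrite /flight_velocity bounce_timeS; lra.
have := archi_boundP (normr_ge0 (2 * B / (g * T))).
set n := Num.bound _ => nB.
have : `|bounce_velocity g T c d (bounce_time T c d n)| <= B.
  apply: vB => /=; exists (bounce_time T c d n) => //=.
  by rewrite in_itv/= andbT -[leLHS](bounce_time0 T c d) incr_le// => k;
  exact: bounce_time_incr.
rewrite vn; apply/negP; rewrite -ltNge (lt_le_trans _ (ler_norm _))//.
have : 2 * B < g * T * n%:R.
  by rewrite [ltRHS]mulrC -ltr_pdivrMr// (le_lt_trans (ler_norm _)).
have : (n%:R <= (d n)%:R :> R).
  rewrite ler_nat /d (leq_trans _ (leq_addl _ _))// leq_pmull//.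
  by rewrite muln_gt0.
by rewrite -(ler_pM2l gT_gt0); lra.
Qed.

End Existence.

(** * Free fall *)

Section FreeFall.
Context {R : realType}.
Variable g : R.
Implicit Types (a b t x : R) (z v F : R -> R).

Definition parabola (h w s t : R) : R := h + w * (t - s) - g / 2 * (t - s) ^+ 2.

Lemma parabola_derive h w s t :
  is_derive t 1 (parabola h w s) (w - g * (t - s)).
Proof.
rewrite /parabola; apply: is_derive_eq; rewrite /GRing.scale/=; lra.
Qed.

Lemma linear_derive w s t : is_derive t 1 (fun x : R => w - g * (x - s)) (- g).
Proof. by apply: is_derive_eq; rewrite /GRing.scale/=; lra. Qed.

Lemma derive0_itv_cst a b F x y :
  (forall t, a < t < b -> is_derive t 1 F 0) -> a < x < b -> a < y < b -> F x = F y.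
Proof.
move=> F0; wlog xy : x y / x <= y => [hw ax ay|].
  by have [/hw->//|/ltW/hw->] := leP x y.
move=> /andP[ax _] /andP[_ yb].
have abP t : t \in `[x, y] -> a < t < b.
  by rewrite in_itv/= => /andP[xt ty]; rewrite (lt_le_trans ax xt) (le_lt_trans ty yb).
have [||c _] := @MVT_segment _ F (cst 0) x y xy.
- by move=> t /(@subset_itv_oo_cc _ _ x y)/abP/F0.
- apply: continuous_in_subspaceT => t; rewrite inE/= => /abP/F0.
  exact: is_derive_continuous.
- by rewrite mul0r => /eqP; rewrite subr_eq0 => /eqP.
Qed.

Lemma free_fall_parabola a b z v x t :
  (forall t, a < t < b -> free_fall g z v t) -> a < x < b -> a < t < b ->
  v t = v x - g * (t - x) /\ z t = parabola (z x) (v x) x t.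
Proof.
move=> zv xab tab.
have vE y : a < y < b -> v y = v x - g * (y - x).
  move=> yab.
  have : v y - (v x - g * (y - x)) = v x - (v x - g * (x - x)).
    apply: (@derive0_itv_cst a b (fun y => v y - (v x - g * (y - x)))) => // s sab.
    have [_ vs] := zv s sab; have ls := linear_derive (v x) x s.
    by apply: is_derive_eq; rewrite subrr.
  by lra.
split; first exact: vE.
have : z t - parabola (z x) (v x) x t = z x - parabola (z x) (v x) x x.
  apply: (@derive0_itv_cst a b (fun y => z y - parabola (z x) (v x) x y)) => // s sab.
  have [zs _] := zv s sab; have ps := parabola_derive (z x) (v x) x s.
  by apply: is_derive_eq; rewrite vE// subrr.
by rewrite /parabola; lra.
Qed.

(** Moving the base point of the parabola to a limit of times along [G]: with
    [G] a one-sided neighbourhood filter, the motion on one side of a collision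
    is the parabola through the one-sided limits at the collision. *)
Lemma free_fall_limit a b z v t zt vt (G : set_system R) {FG : ProperFilter G} :
  (forall t, a < t < b -> free_fall g z v t) ->
  G --> t -> (\forall x \near G, a < x < b) ->
  z @ G --> zt -> v @ G --> vt ->
  forall x, a < x < b -> v x = vt - g * (x - t) /\ z x = parabola zt vt t x.
Proof.
move=> zv Gt Gab zG vG x xab.
have lim_eq F F' l : {for t, continuous F'} -> F @ G --> l ->
    (forall y, a < y < b -> F y = F' y) -> l = F' t.
  move=> F't Fl FF'; apply: (cvg_unique _ Fl) => //.
  apply: cvg_trans (cvg_trans (cvg_app F' Gt) F't).
  by apply: near_eq_cvg; near=> y; rewrite FF'//; near: y.
have vtE : vt = v x - g * (t - x).
  apply: (lim_eq v (fun y => v x - g * (y - x))) => //.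
    exact: is_derive_continuous (linear_derive _ _ _).
  by move=> y yab; have [] := free_fall_parabola zv xab yab.
have ztE : zt = parabola (z x) (v x) x t.
  apply: (lim_eq z (parabola (z x) (v x) x)) => //.
    exact: is_derive_continuous (parabola_derive _ _ _ _).
  by move=> y yab; have [] := free_fall_parabola zv xab yab.
by rewrite ztE vtE /parabola; split; lra.
Unshelve. all: by end_near. Qed.

(** A collision that does not change the velocity is no event at all: the
    parabolas on its two sides have the same height and velocity there. *)
Lemma free_fall_through a b z v t : a < t < b ->
  (forall x, a < x < b -> x != t -> free_fall g z v x) ->
  {for t, continuous z} -> v x @[x --> t^'-] --> v t -> v x @[x --> t^'+] --> v t ->
  free_fall g z v t.
Proof.
move=> /andP[at_ tb] zv zt vl vr.
have atb : a < t < b by rewrite at_.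
have zvE x : a < x < b -> v x = v t - g * (x - t) /\ z x = parabola (z t) (v t) t x.
  move=> /andP[ax xb]; have [xt|tx|->] := ltgtP x t; last first.
  - by rewrite /parabola; split; lra.
  - apply: (@free_fall_limit t b z v t (z t) (v t) t^'+) => //.
    + move=> y /andP[ty yb]; apply: zv; last by rewrite gt_eqF.
      by rewrite yb (lt_trans at_).
    + exact: cvg_at_right_filter cvg_id.
    + exact: (near_itv_right tb).
    + exact: cvg_at_right_filter.
    + by rewrite tx.
  - apply: (@free_fall_limit a t z v t (z t) (v t) t^'-) => //.
    + move=> y /andP[ay yt]; apply: zv; last by rewrite lt_eqF.
      by rewrite ay (lt_trans yt).
    + exact: cvg_at_left_filter cvg_id.
    + exact: (near_itv_left at_).
    + exact: cvg_at_left_filter.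
    + by rewrite ax.
split.
  apply: (@near_eq_is_derive _ _ _ (parabola (z t) (v t) t)).
    by apply: near_itv atb _ => x /zvE[_ ->].
  by apply: is_derive_eq (parabola_derive _ _ _ _) _; rewrite subrr mulr0 subr0.
apply: near_eq_is_derive (linear_derive (v t) t t).
by apply: near_itv atb _ => x /zvE[->].
Qed.

End FreeFall.

(** * Transversal collisions of the upper ball *)

Lemma continuous_close_left {R : realType} (F : R -> R) (a s e : R) :
  {for s, continuous F} -> a < s -> 0 < e ->
  exists2 b, a < b < s & forall t, b <= t <= s -> `|F t - F s| < e.
Proof.
move=> /cvgrPdist_lt Fs as_ e0; have /nbhs_ballP[d /= d0 dF] := Fs e e0.
(* The midpoint keeps the witness strictly to the right of [a]. *)
exists (Num.max ((a + s) / 2) (s - d / 2)).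
  by rewrite lt_max gt_max midf_lt//=; lra.
move=> t; rewrite ge_max => /andP[/andP[_ dt] ts]; rewrite distrC; apply: dF.
by rewrite /ball/= ger0_norm; lra.
Qed.

Section Gap.
Context {R : realType}.
Variables (g : R) (f : R -> R) (s w : R).
Hypothesis f_C1 : class_C1 f.

(** Height above the plate of a ball that would meet it at time [s] with
    velocity [w]; being extended past [s] it is of class C1 on the whole line. *)
Definition gap t := parabola g (f s) w s t - f t.

Definition gap_rate t := w - g * (t - s) - derive1 f t.

Lemma gap_derive (t : R) : is_derive t 1 gap (gap_rate t).
Proof.
have ps := parabola_derive g (f s) w s t; have fs := C1_is_derive f_C1 t.
exact: is_deriveB.
Qed.

Lemma gap_rate_continuous : continuous gap_rate.
Proof.
move=> t; apply: (@continuousB _ _ _ (fun t => w - g * (t - s)) (derive1 f)).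
  exact: is_derive_continuous (linear_derive _ _ _ _).
exact: f_C1.2.
Qed.

Lemma gap_end : gap s = 0.
Proof. by rewrite /gap /parabola subrr expr0n/=; lra. Qed.

Lemma gap_rate_end : gap_rate s = w - derive1 f s.
Proof. by rewrite /gap_rate subrr mulr0 subr0. Qed.

End Gap.

Section TransversalCollision.
Context {R : realType}.
Variables (g T : R) (f : R -> R) (s0 : R) (z2 v2 : R -> R).
Hypotheses (g_gt0 : 0 < g) (T_gt0 : 0 < T) (f_per : periodic f T) (f_C1 : class_C1 f)
  (mot : P2_motion g f s0 z2 v2).

Lemma P2_collision_isolated t : s0 < t -> exists a b : R,
  [/\ s0 <= a, a < t < b & forall x, a < x < b -> x != t -> f x < z2 x].
Proof.
move=> s0t.
pose S := [set x | s0 <= x <= t + 1 /\ z2 x = f x] `\ t.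
have Sclosed : closed S.
  apply: (accessible_finite_set_closed.1 (hausdorff_accessible _)).
    exact: norm_hausdorff.
  exact/finite_setD/(P2_discrete mot).
have : \forall x \near t, ~ S x.
  by apply: open_nbhs_nbhs; split; [exact: closed_openC | case=> _; exact].
move=> /nbhs_ballP[e /= e0 eS].
exists (Num.max s0 (t - e)), (Num.min (t + 1) (t + e)); split.
- by rewrite le_max lexx.
- by rewrite gt_max s0t lt_min ltrBlDr !ltrDl e0 ltr01.
- move=> x; rewrite gt_max lt_min => /andP[/andP[s0x tex] /andP[xt1 xte]] xt.
  rewrite lt_neqAle (P2_above mot (ltW s0x)) andbT; apply/eqP => fz.
  apply: (eS x); last by split; [split => //; rewrite !ltW|exact/eqP].
  by rewrite /ball/= ltr_norml; apply/andP; split; lra.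
Qed.

Lemma P2_height_continuous t : s0 < t -> {for t, continuous z2}.
Proof.
move=> s0t; have [+ _] := (continuous_within_itvcyP s0 z2).1 (P2_continuous mot).
by apply; rewrite in_itv/= s0t.
Qed.

(** If every collision were grazing, i.e. with incoming velocity equal to that
    of the plate, no collision would change the velocity; the ball would then
    fall freely for ever and sink below the minimum of [f]. *)
Lemma P2_nongrazing_collision : exists t vm, [/\ s0 < t, z2 t = f t,
  v2 x @[x --> t^'-] --> vm, v2 t = - vm + 2 * derive1 f t & vm != derive1 f t].
Proof.
apply: contrapT => grazing.
have fall t : s0 < t -> free_fall g z2 v2 t.
  move=> s0t; have [zt|/eqP zt] := eqVneq (z2 t) (f t); last first.
    apply: (P2_free mot) => //; rewrite lt_neqAle (P2_above mot (ltW s0t)) andbT.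
    by apply/eqP => /esym.
  have [vm [vmE vtE]] := P2_plate mot s0t zt.
  have [vmf|vmf] := eqVneq vm (derive1 f t); last first.
    by exfalso; apply: grazing; exists t, vm.
  have [a [b [s0a atb ab]]] := P2_collision_isolated s0t.
  apply: (free_fall_through atb).
  - move=> x xab xt; apply: (P2_free mot); last exact: ab.
    by move: xab => /andP[ax _]; exact: le_lt_trans ax.
  - exact: P2_height_continuous.
  - by rewrite vtE -vmf mulr_natl mulr2n addKr.
  - exact: (P2_rcontinuous mot (ltW s0t)).
have [c cmin] : exists c, forall x, f c <= f x.
  have [||c cmax] := @periodic_attains_max _ (fun x => - f x) T T_gt0.
  - by move=> x; rewrite f_per.
  - by move=> x; apply: continuousN; exact: (C1_continuous f_C1).
  - by exists c => x; rewrite -lerN2.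
pose x := s0 + 1; set B := `|z2 x - f c|; set A := `|v2 x|.
have B0 : 0 <= B := normr_ge0 _; have A0 : 0 <= A := normr_ge0 _.
have zB : z2 x - f c <= B := ler_norm _.
have vA : v2 x <= A := ler_norm _.
(* After the time [r] the parabola is below [f c]. *)
pose r := 1 + (2 * A + 2 * B) / g.
have r1 : 1 <= r by rewrite lerDl divr_ge0 ?(ltW g_gt0)// addr_ge0// mulr_ge0.
have gr : g * r = g + 2 * A + 2 * B.
  by rewrite /r mulrDr mulr1 mulrCA divff ?mulr1 ?addrA// gt_eqF.
have [|||_ zr] := @free_fall_parabola _ g s0 (x + r + 1) z2 v2 x (x + r).
- by move=> t /andP[s0t _]; exact: fall.
- by rewrite /x; apply/andP; split; lra.
- by rewrite /x; apply/andP; split; lra.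
have s0r : s0 <= x + r by rewrite /x; lra.
have := le_trans (cmin (x + r)) (P2_above mot s0r).
rewrite zr /parabola (_ : x + r - x = r); last by rewrite addrC addKr.
have -> : g / 2 * r ^+ 2 = (g + 2 * A + 2 * B) / 2 * r by rewrite -gr expr2; lra.
have : v2 x * r <= A * r by rewrite ler_wpM2r// (le_trans ler01).
have : 0 <= B * (r - 1) by rewrite mulr_ge0 ?subr_ge0.
have : 0 < g * r by rewrite mulr_gt0// (lt_le_trans ltr01).
by lra.
Qed.

(** At a collision that is not grazing, the plate approaches the falling ball
    at a positive rate: a negative rate would put the ball below the plate just
    before the collision. *)
Lemma P2_transversal_collision : exists a s w, [/\ s0 <= a, a < s, w < derive1 f s &
  forall t, a < t < s -> [/\ f t < z2 t, free_fall g z2 v2 t,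
    v2 t = w - g * (t - s) & z2 t = parabola g (f s) w s t]].
Proof.
have [s [w [s0s zs vw vs wf]]] := P2_nongrazing_collision.
have [a [b [s0a /andP[as_ sb] ab]]] := P2_collision_isolated s0s.
have above t : a < t < s -> f t < z2 t.
  move=> /andP[at_ ts]; apply: ab; last by rewrite lt_eqF.
  by rewrite at_ (lt_trans ts).
have fall t : a < t < s -> free_fall g z2 v2 t.
  move=> ats; apply: (P2_free mot); last exact: above.
  by move: ats => /andP[at_ _]; exact: le_lt_trans at_.
have expl t : a < t < s -> v2 t = w - g * (t - s) /\ z2 t = parabola g (f s) w s t.
  apply: (@free_fall_limit _ g a s z2 v2 s (f s) w s^'-) => //.
  - exact: cvg_at_left_filter cvg_id.
  - exact: (near_itv_left as_).
  - by rewrite -zs; apply: cvg_at_left_filter; exact: P2_height_continuous.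
exists a, s, w; split => //; last first.
  by move=> t ats; have [] := expl t ats; split=> //; [exact: above|exact: fall].
rewrite ltNge le_eqVlt eq_sym (negbTE wf)/=; apply/negP => fw.
have h's : 0 < gap_rate g f s w s by rewrite gap_rate_end subr_gt0.
have [b' /andP[ab' bs] b'h] :=
  continuous_close_left (@gap_rate_continuous _ g f s w f_C1 s) as_ h's.
have [|c] := MVT bs (fun t _ => gap_derive g s w f_C1 t).
  apply: continuous_subspaceT => t; exact: is_derive_continuous (gap_derive g s w f_C1 t).
rewrite in_itv/= => /andP[bc cs]; rewrite gap_end sub0r.
have : 0 < gap_rate g f s w c.
  by have := b'h c; rewrite !ltW// ltr_norml => /(_ isT)/andP[]; lra.
move=> h'c; have ab's : a < b' < s by rewrite ab' bs.
have [_ z2b'] := expl b' ab's; have := above b' ab's; rewrite /gap -z2b'.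
have : 0 < gap_rate g f s w c * (s - b') by rewrite mulr_gt0// subr_gt0.
lra.
Qed.

End TransversalCollision.

(** * Reflections between the upper ball and the plate *)

(** In the frame of the upper ball gravity disappears: the massless ball moves
    at constant speed between a wall at depth 0, the upper ball, and a wall at
    depth [h], the plate, which closes in on the upper ball at a rate between
    [m] and [M] and reaches it at time [s]. *)
Section Squeeze.
Context {R : realType}.
Variables (h h' : R -> R) (a s m M : R).
Hypotheses (h_derive : forall x : R, is_derive x 1 h (h' x)) (h_s : h s = 0)
  (m_gt0 : 0 < m) (h'_bounds : forall x, a <= x <= s -> m <= - h' x <= M).

Lemma gap_slope x y : a <= x -> x <= y -> y <= s ->
  m * (y - x) <= h x - h y <= M * (y - x).
Proof.
move=> ax xy ys; have [|c cxy E] := MVT_segment xy (fun t _ => h_derive t).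
  by apply: continuous_subspaceT => t; exact: is_derive_continuous (h_derive t).
have -> : h x - h y = - h' c * (y - x) by rewrite mulNr -E opprB.
move: cxy; rewrite in_itv/= => /andP[xc cy].
have /andP[mc cM] : m <= - h' c <= M.
  by apply: h'_bounds; rewrite (le_trans ax xc) (le_trans cy ys).
by rewrite !ler_wpM2r ?subr_ge0.
Qed.

Lemma gap_gt0 x : a <= x < s -> 0 < h x.
Proof.
move=> /andP[ax xs]; have /andP[+ _] := gap_slope ax (ltW xs) (lexx s).
by rewrite h_s subr0; apply: lt_le_trans; rewrite mulr_gt0 ?subr_gt0.
Qed.

(** Between two hits on the plate the massless ball covers the depth [h t] up
    to the upper ball and the depth [h t'] down again, all at speed [p].  Being
    faster than the plate, it has time for this before the walls meet. *)
Lemma next_plate_hit t p : a <= t < s -> M < p ->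
  exists2 t', t < t' < s & p * (t' - t) = h t + h t'.
Proof.
move=> ats Mp; have ht := gap_gt0 ats; move: (ats) => /andP[at_ ts].
have /andP[_ hM] := gap_slope at_ (ltW ts) (lexx s).
have M0 : 0 < M.
  have /h'_bounds/andP[ms sM] : a <= s <= s by rewrite lexx (le_trans at_ (ltW ts)).
  exact: lt_le_trans m_gt0 (le_trans ms sM).
have hp : h t < p * (s - t).
  move: hM; rewrite h_s subr0 => /le_lt_trans; apply.
  by rewrite ltr_pM2r ?subr_gt0.
(* After its reflection at the upper ball the massless ball has the depth
   [p * (x - t) - h t]; it meets the plate where this equals [h x]. *)
have [||c] := @IVT _ (fun x => p * (x - t) - h x) t s (h t) (ltW ts).
- apply: continuous_subspaceT => x.
  have hx := h_derive x.
  have : is_derive x 1 (fun x : R => p * (x - t) - h x) (p - h' x).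
    by apply: is_derive_eq; rewrite /GRing.scale/=; lra.
  exact: is_derive_continuous.
- rewrite subrr mulr0 h_s sub0r subr0 ge_min le_max; apply/andP; split.
    by apply/orP; left; lra.
  by rewrite (ltW hp) orbT.
rewrite in_itv/= => /andP[tc cs] E; exists c; last by rewrite -E subrK.
apply/andP; split; rewrite lt_neqAle ?tc ?cs andbT; apply/eqP => cE.
  by move: E; rewrite -cE subrr mulr0; lra.
by move: E; rewrite cE h_s subr0 => E; move: hp; rewrite E ltxx.
Qed.

(** A hit on the plate raises the speed by twice the closing rate, so that the
    condition [M < p] of the previous lemma persists for ever. *)
Lemma plate_hits t0 p0 : a <= t0 < s -> M < p0 -> exists t p : nat -> R,
  [/\ t 0 = t0, p 0 = p0 & forall n,
    [/\ a <= t n < s, M < p n, t n < t n.+1,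
        p n * (t n.+1 - t n) = h (t n) + h (t n.+1) &
        p n.+1 = p n - 2 * h' (t n.+1)]].
Proof.
move=> at0 Mp0.
pose X := {x : R * R | a <= x.1 < s /\ M < x.2}.
have next (x : X) : {y : X | [/\ (sval x).1 < (sval y).1,
    (sval x).2 * ((sval y).1 - (sval x).1) = h (sval x).1 + h (sval y).1 &
    (sval y).2 = (sval x).2 - 2 * h' (sval y).1]}.
  apply: cid; case: x => -[t p] /= [ats Mp].
  have [t' /andP[tt' t's] E] := next_plate_hit ats Mp.
  move: ats => /andP[at_ ts].
  have yP : a <= t' < s /\ M < p - 2 * h' t'.
    have at' : a <= t' by rewrite (le_trans at_ (ltW tt')).
    split; first by rewrite at' t's.
    have /andP[mt' _] : m <= - h' t' <= M by apply: h'_bounds; rewrite at' ltW.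
    by move: m_gt0; lra.
  by exists (exist _ (t', p - 2 * h' t') yP).
have [F [F0 FS]] := dependent_choice next (exist _ (t0, p0) (conj at0 Mp0)).
exists (fun n => (sval (F n)).1), (fun n => (sval (F n)).2); rewrite F0.
by split=> // n; have [? ? ?] := FS n; have [] := svalP (F n); split.
Qed.

End Squeeze.

Section Trapped.
Context {R : realType}.
Variables (h h' : R -> R) (a s m M : R).
Hypotheses (h_derive : forall x : R, is_derive x 1 h (h' x)) (h_s : h s = 0)
  (m_gt0 : 0 < m) (h'_bounds : forall x, a <= x <= s -> m <= - h' x <= M).
Variables (t p : nat -> R).
Hypotheses (t_itv : forall n, a <= t n < s) (p_gt : forall n, M < p n)
  (t_incr : forall n, t n < t n.+1)
  (t_next : forall n, p n * (t n.+1 - t n) = h (t n) + h (t n.+1))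
  (p_next : forall n, p n.+1 = p n - 2 * h' (t n.+1)).

Let M_gt0 : 0 < M.
Proof.
have /andP[at_ ts] := t_itv 0.
have /h'_bounds/andP[ms sM] : a <= s <= s by rewrite lexx (le_trans at_ (ltW ts)).
exact: lt_le_trans m_gt0 (le_trans ms sM).
Qed.

Let p_gt0 n : 0 < p n. Proof. exact: lt_trans M_gt0 (p_gt n). Qed.

Let h_gt0 n : 0 < h (t n).
Proof. exact: (gap_gt0 h_derive h_s m_gt0 h'_bounds (t_itv n)). Qed.

Definition ball_time n := t n + h (t n) / p n.

Lemma ball_timeE n : p n * (ball_time n - t n) = h (t n).
Proof. by rewrite /ball_time addrC addKr mulrCA divff ?mulr1// gt_eqF. Qed.

(** Hits on the plate and on the upper ball alternate; interleaving them in one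
    sequence makes the flight a piecewise linear function of a single index. *)
Definition hit_time k := if odd k then ball_time k./2 else t k./2.

(** Depth below the upper ball between the hits [k] and [k.+1]; even pieces
    rise to the upper ball, odd ones return to the plate. *)
Definition depth k x : R :=
  (if odd k then 1 else - 1) * (p k./2 * (x - t k./2) - h (t k./2)).

Definition depth_rate k (x : R) : R := (if odd k then 1 else - 1) * p k./2.

Let u := hit_time.

Lemma hit_time_plate n : u n.*2 = t n.
Proof. by rewrite /u /hit_time odd_double doubleK. Qed.

Lemma hit_time_ball n : u n.*2.+1 = ball_time n.
Proof. by rewrite /u /hit_time /= odd_double /= uphalf_double. Qed.

Lemma depth_plate n x : depth n.*2 x = h (t n) - p n * (x - t n).
Proof. by rewrite /depth odd_double doubleK mulN1r opprB. Qed.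

Lemma depth_ball n x : depth n.*2.+1 x = p n * (x - ball_time n).
Proof.
rewrite /depth /= odd_double /= uphalf_double mul1r -[h (t n)]ball_timeE.
by rewrite -mulrBr; congr (_ * _); lra.
Qed.

Lemma depth_rate_plate n x : depth_rate n.*2 x = - p n.
Proof. by rewrite /depth_rate odd_double doubleK mulN1r. Qed.

Lemma depth_rate_ball n x : depth_rate n.*2.+1 x = p n.
Proof. by rewrite /depth_rate /= odd_double /= uphalf_double mul1r. Qed.

Lemma even_or_odd k : exists n, k = n.*2 \/ k = n.*2.+1.
Proof.
exists k./2; rewrite -{1 3}[k]odd_double_half.
by case: (odd k); [right | left].
Qed.

Lemma ball_time_itv n : t n < ball_time n < t n.+1.
Proof.
have := ball_timeE n; have := t_next n; have := h_gt0 n; have := h_gt0 n.+1.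
move=> h1 h0 E1 E0; rewrite -subr_gt0 -(pmulr_rgt0 _ (p_gt0 n)) E0 h0/=.
rewrite -subr_gt0 -(pmulr_rgt0 _ (p_gt0 n)).
suff -> : p n * (t n.+1 - ball_time n) = h (t n.+1) by [].
by move: E1 E0; rewrite !mulrBr; lra.
Qed.

Lemma hit_time_incr k : u k < u k.+1.
Proof.
have [n [->|->]] := even_or_odd k; have /andP[tb bt] := ball_time_itv n.
  by rewrite hit_time_plate hit_time_ball.
by rewrite hit_time_ball -doubleS hit_time_plate.
Qed.

Lemma depth_match k : depth k (u k.+1) = depth k.+1 (u k.+1).
Proof.
have [n [->|->]] := even_or_odd k.
  by rewrite depth_plate depth_ball hit_time_ball ball_timeE !subrr mulr0.
rewrite -doubleS depth_plate depth_ball hit_time_plate subrr mulr0 subr0.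
by have := t_next n; have := ball_timeE n; rewrite !mulrBr; lra.
Qed.

Lemma depth_derive k (x : R) : is_derive x 1 (depth k) (depth_rate k x).
Proof.
by rewrite /depth /depth_rate; apply: is_derive_eq; rewrite /GRing.scale/=; lra.
Qed.

(** Before its hit on the upper ball the massless ball is above the plate
    because it is faster, and after that hit because the plate has not yet
    risen to the depth at which they meet again. *)
Lemma depth_itv k x : u k < x < u k.+1 -> 0 < depth k x < h x.
Proof.
have [n [->|->]] := even_or_odd k;
  have [/andP[at_ ts] /andP[at' ts']] := (t_itv n, t_itv n.+1).
  rewrite hit_time_plate hit_time_ball depth_plate => /andP[tx xb].
  have /andP[tb bt] := ball_time_itv n.
  have xs : x <= s by rewrite ltW// (lt_trans xb)// (lt_trans bt).
  have /andP[_ hM] := gap_slope h_derive h'_bounds at_ (ltW tx) xs.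
  rewrite -[h (t n)]ball_timeE -mulrBr mulr_gt0/=; [|exact: p_gt0|lra].
  have : M * (x - t n) < p n * (x - t n) by rewrite ltr_pM2r ?subr_gt0.
  by have := ball_timeE n; rewrite !mulrBr; move: hM; rewrite !mulrBr; lra.
rewrite -doubleS hit_time_plate hit_time_ball depth_ball => /andP[bx xt].
have /andP[tb bt] := ball_time_itv n.
have ax : a <= x by rewrite (le_trans at_)// ltW// (lt_trans tb).
rewrite mulr_gt0 ?subr_gt0//=.
have /andP[hm _] := gap_slope h_derive h'_bounds ax (ltW xt) (ltW ts').
have : 0 < m * (t n.+1 - x) by rewrite mulr_gt0 ?subr_gt0.
have : 0 < p n * (t n.+1 - x) by rewrite mulr_gt0 ?subr_gt0.
have := t_next n; have := ball_timeE n.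
by move: hm; rewrite !mulrBr; lra.
Qed.

Lemma plate_speed_ge n : p 0 + 2 * m * n%:R <= p n.
Proof.
elim: n => [|n IH]; first by rewrite mulr0 addr0.
rewrite p_next -[in leLHS](addn1 n) natrD mulrDr mulr1 addrA.
have /andP[mh _] : m <= - h' (t n.+1) <= M.
  by apply: h'_bounds; have /andP[-> /ltW ->] := t_itv n.+1.
by lra.
Qed.

Lemma plate_speed_nondecreasing k n : (n.*2 <= k)%N -> p n <= p k./2.
Proof.
move=> nk; have : (n <= k./2)%N by rewrite -[n]doubleK half_leq.
apply: incr_le => i; rewrite p_next.
have /andP[mh _] : m <= - h' (t i.+1) <= M.
  by apply: h'_bounds; have /andP[-> /ltW ->] := t_itv i.+1.
by have := m_gt0; lra.
Qed.

(** The hits accumulate here; the speed diverges at this time already because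
    each hit on the plate adds at least [2 m] to it. *)
Definition blowup_time := sup (range t).

Let t_sup : has_sup (range t).
Proof.
split; first by exists (t 0), 0%N.
by exists s => _ [n _ <-]; have /andP[_ /ltW] := t_itv n.
Qed.

Lemma t_lt_blowup n : t n < blowup_time.
Proof.
apply: lt_le_trans (t_incr n) _; apply: ub_le_sup; last by exists n.+1.
by case: t_sup.
Qed.

Lemma blowup_le : blowup_time <= s.
Proof.
apply: ge_sup; first by exists (t 0), 0%N.
by move=> _ [n _ <-]; have /andP[_ /ltW] := t_itv n.
Qed.

Lemma lt_blowup x : x < blowup_time -> exists n, x < t n.
Proof.
move=> xb; have xb0 : 0 < blowup_time - x by rewrite subr_gt0.
have [_ [n _ <-]] := sup_adherent xb0 t_sup.
by rewrite opprB addrC subrK; exists n.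
Qed.

Variables (g a0 B : R) (f z2 v2 : R -> R).
Hypotheses (a0_lt : a0 < a)
  (ball_falls : forall x, a0 < x < s -> free_fall g z2 v2 x)
  (hE : forall x, a0 < x < s -> h x = z2 x - f x)
  (h'E : forall x, a0 < x < s -> h' x = v2 x - derive1 f x)
  (ball_speed : forall x, a0 < x < s -> `|v2 x| <= B).

Definition trapped_height x := z2 x - piecewise u depth x.
Definition trapped_velocity x := v2 x - piecewise u depth_rate x.

Let in_flight x : t 0 <= x -> x < blowup_time -> a0 < x < s.
Proof.
move=> tx xb; rewrite (lt_le_trans xb blowup_le) andbT.
by have /andP[at_ _] := t_itv 0; rewrite (lt_le_trans a0_lt)// (le_trans at_).
Qed.

Lemma hit_time_cover x : t 0 <= x -> x < blowup_time -> exists k, u k <= x < u k.+1.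
Proof.
move=> tx /lt_blowup[n xn].
by apply: (@piece_exists _ _ _ n.*2); rewrite ?(hit_time_plate 0)// hit_time_plate.
Qed.

Let depthE k x : u k <= x < u k.+1 -> piecewise u depth x = depth k x.
Proof. exact: (piecewiseE hit_time_incr). Qed.

Let depth_rateE k x : u k <= x < u k.+1 -> piecewise u depth_rate x = depth_rate k x.
Proof. exact: (piecewiseE hit_time_incr). Qed.

Let at_hit k : u k <= u k < u k.+1.
Proof. by rewrite lexx hit_time_incr. Qed.

(** Case analysis on the depth at a given time.  The three cases are exclusive,
    as [h] is positive before [s]: a contact with the plate or with the upper
    ball can only be one of the listed hits. *)
Variant hit_spec x : R -> Prop :=
  | HitPlate n of x = t n : hit_spec x (h x)
  | HitBall n of x = ball_time n : hit_spec x 0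
  | HitNone k d of u k < x < u k.+1 & 0 < d < h x : hit_spec x d.

Lemma hitP x : t 0 <= x -> x < blowup_time -> hit_spec x (piecewise u depth x).
Proof.
move=> tx xb; have [k ukx] := hit_time_cover tx xb.
rewrite (depthE ukx); move: ukx => /andP[]; rewrite le_eqVlt => /orP[/eqP ux _|ux xu].
  have [n [kE|kE]] := even_or_odd k; rewrite kE in ux *.
    move: ux; rewrite hit_time_plate => <-.
    by rewrite depth_plate subrr mulr0 subr0; apply: (HitPlate (n := n)).
  move: ux; rewrite hit_time_ball => <-.
  by rewrite depth_ball subrr mulr0; apply: (HitBall (n := n)).
have uxu : u k < x < u k.+1 by rewrite ux.
exact: HitNone uxu (depth_itv uxu).
Qed.

Let h_pos x : t 0 <= x -> x < blowup_time -> 0 < h x.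
Proof.
move=> tx xb; apply: (gap_gt0 h_derive h_s m_gt0 h'_bounds).
rewrite (lt_le_trans xb blowup_le) andbT.
by have /andP[at_ _] := t_itv 0; rewrite (le_trans at_).
Qed.

Lemma trapped_motion : P1_motion g f z2 v2 (v2 (t 0) + p 0) (t 0) blowup_time
  trapped_height trapped_velocity.
Proof.
have at_t0 : u 0 <= t 0 < u 1.
  by have := at_hit 0.*2; rewrite hit_time_plate.
have depth_rate_cont k x : {for x, continuous (depth_rate k)} by exact: cvg_cst.
have depth_cont k : continuous (depth k).
  by move=> x; exact: is_derive_continuous (depth_derive k x).
have v2_cont x : t 0 <= x -> x < blowup_time -> {for x, continuous v2}.
  by move=> tx xb; have [_ /is_derive_continuous] := ball_falls (in_flight tx xb).
split.
- rewrite /trapped_height (depthE at_t0) (depth_plate 0) subrr mulr0 subr0.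
  by rewrite hE ?subKr// in_flight// t_lt_blowup.
- by rewrite /trapped_velocity (depth_rateE at_t0) (depth_rate_plate 0) opprK.
- move=> x /andP[tx xb]; rewrite -subr_gt0 -hE; first exact: h_pos.
  exact: in_flight.
- move=> x /andP[tx xb]; rewrite /trapped_height.
  have := hE (in_flight tx xb); have := h_pos tx xb.
  by case: (hitP tx xb) => [n _|n _|k d _ /andP[d0 dh]] h0 hx; apply/andP; split; lra.
- apply: continuous_in_subspaceT => x; rewrite inE/= in_itv/= => /andP[tx xb].
  have [n xn] := lt_blowup xb.
  apply: continuousB.
    by have [/is_derive_continuous] := ball_falls (in_flight tx xb).
  apply: (@piecewise_continuous _ _ hit_time_incr _ depth_cont depth_match n.*2).
  by rewrite (hit_time_plate 0) hit_time_plate tx.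
- move=> x /andP[tx xb]; have [k ukx] := hit_time_cover tx xb.
  apply: cvgB; first exact/cvg_at_right_filter/v2_cont.
  by apply: (piecewise_cvg_right hit_time_incr ukx).
- move=> x /andP[/ltW tx xb]; have := hE (in_flight tx xb); rewrite /trapped_height.
  case: (hitP tx xb) => [n _ ->|n _ _|k d uxu dh _ _].
  + by rewrite subKr ltxx.
  + by rewrite subr0 ltxx andbF.
  + have [zx vx] := ball_falls (in_flight tx xb).
    have ukx : u k <= x < u k.+1 by move: uxu => /andP[/ltW -> ->].
    split.
      rewrite /trapped_velocity (depth_rateE ukx).
      apply: is_deriveB; apply: (piecewise_derive hit_time_incr uxu).
      exact: depth_derive.
    rewrite -[- g]subr0; apply: is_deriveB.
    apply: (piecewise_derive hit_time_incr uxu); exact: is_derive_cst.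
- move=> x /andP[tx xb]; have := hE (in_flight (ltW tx) xb); rewrite /trapped_height.
  case: (hitP (ltW tx) xb) => [[|n] xE _ _|n _ hx zx|k d _ /andP[d0 dh] hx zx].
  + by move: tx; rewrite xE ltxx.
  + exists (v2 x - p n); split.
      apply: cvgB; first exact/cvg_at_left_filter/v2_cont/xb/ltW.
      rewrite -(depth_rate_ball n x); apply: (piecewise_cvg_left hit_time_incr) => //.
      rewrite -/u -doubleS hit_time_plate hit_time_ball xE lexx andbT.
      by case/andP: (ball_time_itv n).
    rewrite /trapped_velocity (@depth_rateE n.+1.*2); last by rewrite xE -hit_time_plate.
    rewrite depth_rate_plate p_next -xE h'E; last exact: in_flight (ltW tx) xb.
    by lra.
  + by have := h_pos (ltW tx) xb; lra.
  + by lra.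
- move=> x /andP[tx xb]; rewrite /trapped_height.
  have := h_pos (ltW tx) xb.
  case: (hitP (ltW tx) xb) => [n _ h0 zx|n xE _ _|k d _ /andP[d0 dh] _ zx];
    [by lra| |by lra].
  exists (v2 x + p n); split.
    rewrite -[p n]opprK; apply: cvgB; first exact/cvg_at_left_filter/v2_cont/xb/ltW.
    rewrite -(depth_rate_plate n x); apply: (piecewise_cvg_left hit_time_incr) => //.
    rewrite -/u hit_time_plate hit_time_ball xE lexx andbT.
    by case/andP: (ball_time_itv n).
  rewrite /trapped_velocity (@depth_rateE n.*2.+1); last by rewrite xE -hit_time_ball.
  by rewrite depth_rate_ball; lra.
- move=> b bb; have [N bN] := lt_blowup bb.
  apply: (@sub_finite_set _ _ (t @` `I_N `|` ball_time @` `I_N)); last first.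
    by rewrite finite_setU; split; exact/finite_image/finite_II.
  move=> x [/andP[tx xb] hit]; have xbl := le_lt_trans xb bb.
  have xN n : t n <= x -> (n < N)%N.
    move=> nx; rewrite ltnNge; apply/negP => /(incr_le t_incr).
    by apply/negP; rewrite -ltNge (le_lt_trans nx)// (le_lt_trans xb).
  move: hit; rewrite /trapped_height; have := hE (in_flight tx xbl).
  case: (hitP tx xbl) => [n xE _ _|n xE _ _|k d _ /andP[d0 dh] hx [] zx].
  + by left; exists n => //=; apply: xN; rewrite xE.
  + right; exists n => //=; apply: xN; rewrite xE.
    by have /andP[/ltW] := ball_time_itv n.
  + by lra.
  + by lra.
Qed.

Lemma trapped_blowup : `|trapped_velocity x| @[x --> blowup_time^'-] --> +oo.
Proof.
apply/cvgryPge => A.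
pose n := Num.bound `|(A + B) / (2 * m)|.
have m2 : 0 < 2 * m by rewrite mulr_gt0.
have ABp : A + B <= p n.
  have := p_gt0 0; have := plate_speed_ge n.
  suff : A + B < 2 * m * n%:R by lra.
  by rewrite [ltRHS]mulrC -ltr_pdivrMr// (le_lt_trans (ler_norm _))// archi_boundP.
apply: (near_itv_left (t_lt_blowup n)) => x /andP[tx xb].
have t0x : t 0 <= x by rewrite (le_trans (incr_le t_incr (leq0n n)))// ltW.
have [k ukx] := hit_time_cover t0x xb.
have nk : (n.*2 <= k)%N.
  rewrite leqNgt; apply/negP => kn; have /andP[_] := ukx.
  apply/negP; rewrite -leNgt (le_trans (incr_le hit_time_incr kn))//.
  by rewrite hit_time_plate ltW.
have := plate_speed_nondecreasing nk; have := ball_speed (in_flight t0x xb).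
rewrite /trapped_velocity (depth_rateE ukx) /depth_rate ler_norml => /andP[vB Bv].
by case: (odd k) => pk; rewrite ler_normr; apply/orP; [right | left]; lra.
Qed.

End Trapped.

(** * Initial conditions *)

Lemma open_infinite_ray_itv {R : realType} (V b s : R) : b < s ->
  open (`]V, +oo[ `*` `]b, s[ : set (R * R)) /\
  (@lebesgue_measure R \x @lebesgue_measure R)%E (`]V, +oo[ `*` `]b, s[) = +oo%E.
Proof.
move=> bs; split.
  rewrite openE => -[v t] [/= vV tbs]; exists ([set` `]V, +oo[], [set` `]b, s[]) => //=.
  by split; apply: open_nbhs_nbhs; split=> //.
rewrite product_measure1E//.
transitivity (@lebesgue_measure R `]V, +oo[%classic *
  @lebesgue_measure R `]b, s[%classic)%E => //.
rewrite !lebesgue_measure_itv/= ltry lte_fin bs.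
by rewrite addye// -EFinB gt0_mulye// lte_fin subr_gt0.
Qed.

(** A massless ball that starts from the plate shortly before a transversal
    collision of the upper ball, with a speed relative to that ball above the
    closing rate, is trapped between the two.  The admissible initial velocities
    form a ray, whence the infinite measure. *)
Lemma P2_motion_blowup {R : realType} (g T : R) (f : R -> R) (s0 : R) (z2 v2 : R -> R) :
  0 < g -> 0 < T -> periodic f T -> class_C1 f -> P2_motion g f s0 z2 v2 ->
  open_infinite_blowup g f s0 z2 v2.
Proof.
move=> g_gt0 T_gt0 f_per f_C1 mot.
have [a [s [w [s0a as_ wf asP]]]] := P2_transversal_collision g_gt0 T_gt0 f_per f_C1 mot.
pose h := gap g f s w; pose h' := gap_rate g f s w.
have h_derive (t : R) : is_derive t 1 h (h' t) by exact: gap_derive.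
have h_s : h s = 0 by exact: gap_end.
pose c := derive1 f s - w.
have c0 : 0 < c by rewrite subr_gt0.
have h's : h' s = - c by rewrite /h' gap_rate_end opprB.
have c2 : 0 < c / 2 by rewrite divr_gt0.
have [b /andP[ab bs] bh'] :=
  continuous_close_left (@gap_rate_continuous _ g f s w f_C1 s) as_ c2.
have h'_bounds t : b <= t <= s -> c / 2 <= - h' t <= 3 * c / 2.
  move=> /bh'; rewrite -/(h' t) -/(h' s) h's ltr_norml => /andP[? ?].
  by apply/andP; split; lra.
(* Initial velocities are absolute, whereas the closing rate bounds the speed
   relative to the upper ball; [B] converts between the two. *)
pose B := `|w| + g * (s - a).
have v2B t : a < t < s -> `|v2 t| <= B.
  move=> ats; have [_ _ -> _] := asP t ats; rewrite (le_trans (ler_normB _ _))// lerD2l.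
  move: ats => /andP[at_ ts].
  by rewrite normrM gtr0_norm// ler_pM2l// ler0_norm; lra.
have [oU mU] := open_infinite_ray_itv (3 * c / 2 + B) bs.
exists (`]3 * c / 2 + B, +oo[ `*` `]b, s[); split=> // v0 t0 [/=].
rewrite !in_itv/= andbT => v0B /andP[bt0 t0s].
have at0 : a < t0 < s by rewrite (lt_trans ab).
have bt0s : b <= t0 < s by rewrite ltW.
have Mp0 : 3 * c / 2 < v0 - v2 t0.
  by have := v2B _ at0; rewrite ler_norml => /andP[_]; lra.
have [t [p [t0E p0E tp]]] := plate_hits h_derive h_s c2 h'_bounds bt0s Mp0.
have t_itv n : b <= t n < s by have [] := tp n.
have p_gt n : 3 * c / 2 < p n by have [] := tp n.
have t_incr n : t n < t n.+1 by have [] := tp n.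
have t_next n : p n * (t n.+1 - t n) = h (t n) + h (t n.+1) by have [] := tp n.
have p_next n : p n.+1 = p n - 2 * h' (t n.+1) by have [] := tp n.
split; first by rewrite (le_trans s0a)// ltW//; case/andP: at0.
exists (blowup_time t), (trapped_height h t p z2), (trapped_velocity h t p v2); split.
- by rewrite -t0E; exact: t_lt_blowup t_itv t_incr 0.
- have -> : v0 = v2 (t 0) + p 0 by rewrite t0E p0E addrC subrK.
  rewrite -t0E; apply: (trapped_motion h_derive h_s c2 h'_bounds t_itv p_gt t_incr
    t_next p_next ab).
  + by move=> x /asP[].
  + by move=> x /asP[_ _ _ ->].
  + by move=> x /asP[_ _ -> _].
- exact: (trapped_blowup h_derive h_s c2 h'_bounds t_itv p_gt t_incr t_next p_next
    ab v2B).
Qed.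

Theorem theorem3 (R : realType) (g T : R) (f : R -> R)
    (g_gt0 : 0 < g) (T_gt0 : 0 < T) (f_per : periodic f T) (f_C1 : class_C1 f) :
  ((exists (s0 : R) (z2 v2 : R -> R),
      P2_motion g f s0 z2 v2 /\ P2_bounded s0 v2) /\
   (forall (s0 : R) (z2 v2 : R -> R),
      P2_motion g f s0 z2 v2 -> P2_bounded s0 v2 ->
      open_infinite_blowup g f s0 z2 v2)) /\
  (class_C g T f ->
   (exists (s0 : R) (z2 v2 : R -> R),
      P2_motion g f s0 z2 v2 /\ ~ P2_bounded s0 v2) /\
   (forall (s0 : R) (z2 v2 : R -> R),
      P2_motion g f s0 z2 v2 -> ~ P2_bounded s0 v2 ->
      open_infinite_blowup g f s0 z2 v2)).
Proof.
have blowup s0 z2 v2 : P2_motion g f s0 z2 v2 -> open_infinite_blowup g f s0 z2 v2.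
  exact: (P2_motion_blowup g_gt0 T_gt0 f_per f_C1).
split=> [|fC]; split.
- exact: (bounded_motion_exists g_gt0 T_gt0 f_per f_C1).
- by move=> s0 z2 v2 mot _; exact: blowup.
- exact: (unbounded_motion_exists g_gt0 T_gt0 f_per f_C1 fC).
- by move=> s0 z2 v2 mot _; exact: blowup.
Qed.
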